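(* Let $n\geq 4$. The number of conjugacy classes in the alternating group $A_n$ which are rational is equal to the number of rational-valued complex irreducible characters of $A_n$.
   Context: An element $g$ of a finite group $G$ is rational if $g$ is conjugate in $G$ to $g^m$ for every integer $m$ coprime to the order of $g$; a conjugacy class of $G$ is rational if it is the conjugacy class of a rational element. A character is rational-valued if all of its values lie in $\mathbb{Q}$. *)

(* Defs.v *)
From mathcomp Require Import all_boot all_order all_algebra.
From mathcomp Require Import all_fingroup all_solvable all_field all_character.
From mathcomp Require Import boolp.

Set Implicit Arguments.
Unset Strict Implicit.
Unset Printing Implicit Defensive.

Import GroupScope.

Definition zexpg (gT : finGroupType) (g : gT) (m : int) : gT :=
  match m with
  | Posz k => g ^+ k
  | Negz k => g ^- k.+1
  end.

Definition rational_element (gT : finGroupType) (G : {group gT}) (g : gT) : Prop :=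
  g \in G /\ forall m : int, coprimez m #[g] -> zexpg g m \in g ^: G.

Definition rational_class (gT : finGroupType) (G : {group gT}) (C : {set gT}) : Prop :=
  exists2 g, rational_element G g & C = g ^: G.

(* Values of complex characters of a finite group are algebraic, so [irr G], whose
   members take values in [algC], lists all the complex irreducible characters. *)
Definition rational_valued (gT : finGroupType) (G : {group gT}) (phi : 'CF(G)) : Prop :=
  forall x, x \in G -> phi x \in Crat.

Definition rational_classes (gT : finGroupType) (G : {group gT}) : {set {set gT}} :=
  [set C in classes G | `[< rational_class G C >] ].

Definition rational_irr (gT : finGroupType) (G : {group gT}) : {set Iirr G} :=
  [set i | `[< rational_valued ('chi[G]_i)%R >] ].

(* Main.v *)
Require Import Defs.
From mathcomp Require Import all_boot all_order all_algebra.
From mathcomp Require Import all_fingroup all_solvable all_field all_character.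
From mathcomp Require Import boolp.

Set Implicit Arguments.
Unset Strict Implicit.
Unset Printing Implicit Defensive.

Import GRing.Theory GroupScope.

(** Let N be a multiple of the exponent of the group G. The unit group of Z/N,
which is the Galois group of the N-th cyclotomic field, acts on the classes of
G by powers and on the irreducible characters of G through their values. The
rational classes and the rational-valued irreducible characters are the fixed
points of these two actions ([rational_classes_fix], [rational_irr_fix]).

Brauer's permutation lemma says that each single unit has equally many fixed
points in both actions. This alone does not compare the points fixed by the
whole group, because the group is not cyclic in general, but by the
Cauchy-Frobenius count it shows that the two actions have the same number of
orbits ([card_power_galois_orbits]). When moreover all orbits have at most two
points, the orbit count and the size of the set determine the number of fixed
points, which is twice the former minus the latter ([card_fix_orbits_le2]);
and there are as many classes as irreducible characters.

For G = Alt, orbits are that small because G has index 2 in a group K = Sym all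
of whose elements are rational ([perm_conj_expg]). The powers of x in question
are conjugate to x in K, so the orbit of the G-class of x consists of
K-conjugates of that class, of which there are at most |K : G|. Likewise the
characters of K are rational-valued, so inducing to K identifies all Galois
conjugates of an irreducible character of G, and by Frobenius reciprocity these
are K-conjugates of it ([galois_conjg]). No explicit character values are
involved. *)

(** * Rationality of permutations *)

Lemma iter_perm_expn (T : finType) (s : {perm T}) (r : T) i j m :
  (s ^+ i) r = (s ^+ j) r -> (s ^+ (i * m)) r = (s ^+ (j * m)) r.
Proof.
move=> eq_ij; elim: m => [|m IHm]; first by rewrite !muln0.
rewrite !mulnS expgD permM eq_ij -permM -expgD addnC expgD permM IHm.
by rewrite -permM -expgD addnC.
Qed.

(** Each cycle of s is parametrised by its canonical root r as i |-> s^i r; this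
map multiplies the parameter by m. For m prime to the order of s it is a
permutation that conjugates s to s^m. *)
Definition orbit_power (T : finType) (s : {perm T}) m (x : T) :=
  (s ^+ (findex s (froot s x) x * m)) (froot s x).

(** The parameter i matters only modulo the cycle length, so the formula holds
for every i and not just for the one that [findex] returns. *)
Lemma orbit_power_iter (T : finType) (s : {perm T}) m i (x : T) :
  orbit_power s m ((s ^+ i) (froot s x)) = (s ^+ (i * m)) (froot s x).
Proof.
have fsym := fconnect_sym (@perm_inj T s).
rewrite permX; set y := iter i s _.
have sxy : fconnect s (froot s x) y by apply: fconnect_iter.
have ry : froot s y = froot s x.
  have sxx : fconnect s x y by rewrite (connect_trans (connect_root _ x)).
  exact/esym/(fingraph.rootP fsym).
rewrite /orbit_power ry; apply: iter_perm_expn.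
by rewrite !permX iter_findex.
Qed.

Lemma orbit_power_id (T : finType) (s : {perm T}) (x : T) :
  (s ^+ findex s (froot s x) x) (froot s x) = x.
Proof.
rewrite permX iter_findex // fconnect_sym; last exact: perm_inj.
exact: connect_root.
Qed.

Lemma perm_conj_expg (T : finType) (s : {perm T}) m :
  coprime m #[s] -> exists t : {perm T}, s ^ t = s ^+ m.
Proof.
move=> co_m_s.
have [m' m'K] : exists m', s ^+ (m * m') = s.
  exists (expg_invn <[s]> m).
  by rewrite expgM (expgK _ (cycle_id s)) // coprime_sym.
have yK : cancel (orbit_power s m) (orbit_power s m').
  move=> x; rewrite -[in RHS](orbit_power_id s x) {2}/orbit_power.
  by rewrite orbit_power_iter -mulnA mulnC expgM m'K.
exists (perm (can_inj yK)); apply: (canLR (mulKg _)); apply/permP=> x.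
rewrite !permM !permE -{1}(orbit_power_id s x) -permM -expgSr orbit_power_iter.
by rewrite mulSn addnC expgD permM.
Qed.

(** * Rational elements and rational character values *)

(** Surjectivity of reduction between unit groups of residue rings. Add to m
the multiple d * t of d, where t is the part of N prime to m: a prime of N
divides exactly one of m and d * t, hence not their sum. *)
Lemma coprime_lift m d N : 0 < m -> 0 < N -> coprime m d ->
  exists2 k, coprime k N & k = m %[mod d].
Proof.
move=> m_gt0 N_gt0 co_m_d; pose t := (N`_(\pi(m)^'))%N.
exists (d * t + m)%N; last by rewrite mulnC modnMDl.
rewrite coprime_has_primes ?addn_gt0 ?m_gt0 ?orbT //; apply/hasPn=> p.
rewrite /= !mem_primes addn_gt0 m_gt0 orbT N_gt0 /= => /andP[p_pr p_N].
rewrite p_pr /=; have [p_m | p'm] := boolP (p %| m).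
  rewrite dvdn_addl // Euclid_dvdM // negb_or -!prime_coprime //.
  rewrite (coprime_dvdl p_m) //=; apply: (@pnat_coprime \pi(m)).
    by rewrite pnatE // mem_primes p_pr m_gt0.
  exact: part_pnat.
have p_t : p %| t.
  apply: (@dvdn_trans (N`_p)%N).
    by rewrite p_part dvdn_exp // logn_gt0 mem_primes p_pr N_gt0.
  apply: sub_in_partn => q _ /eqnP->.
  by rewrite !inE mem_primes p_pr m_gt0.
by rewrite dvdn_addr // dvdn_mull.
Qed.

(** Natural exponents suffice, as the inverse of g is one of its powers. *)
Lemma rational_elementP (gT : finGroupType) (G : {group gT}) (g : gT) :
  rational_element G g <->
  g \in G /\ forall k, coprime k #[g] -> g ^+ k \in g ^: G.
Proof.
split=> -[Gg rat_g]; split=> //; [move=> k co_k | case=> k co_k /=].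
- exact: (rat_g (Posz k)).
- exact: rat_g.
rewrite -expVgn invg_expg -expgM; apply: rat_g.
by rewrite coprimeMl coprimePn.
Qed.

(** An orbit of size 1 contributes 1 + 1 to the left side and an orbit of size
2 contributes 2 + 0. *)
Lemma card_fix_orbits_le2 (aT : finGroupType) (A : {group aT}) (sT : finType)
    (to : {action aT &-> sT}) (S : {set sT}) :
    [acts A, on S | to] -> (forall x, x \in S -> #|orbit to A x| <= 2) ->
  (#|S| + #|'Fix_(S | to)(A)| = #|orbit to A @: S| * 2)%N.
Proof.
move=> actsAS orb2.
rewrite -sum1_card -[#|'Fix_(S | to)(A)|]sum1_card.
rewrite (eq_bigl _ _ (fun x => in_setI x _ _)) big_mkcondr -big_split /=.
rewrite (set_partition_big _ (orbit_partition actsAS)) -sum_nat_const /=.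
apply: eq_bigr => _ /imsetP[x Sx ->].
have fixE y : y \in orbit to A x ->
    (y \in 'Fix_to(A)) = (#|orbit to A x| == 1%N).
  move/orbit_eqP=> <-.
  by apply/orbit1P/eqP=> [->|/card_orbit1]; rewrite ?cards1.
rewrite (eq_bigr (fun=> 1 + (#|orbit to A x| == 1)))%N; last first.
  by move=> y /fixE->; case: eqP.
rewrite sum_nat_const; have := orb2 x Sx.
have : 0 < #|orbit to A x|.
  by apply/card_gt0P; exists x; apply: orbit_refl.
by case: #|_| => [|[|[]]].
Qed.

(** On the cyclic group generated by x a character is a sum of linear
characters, whose values at x are roots of unity of order dividing #[x]. *)
Lemma cfAut_expg (gT : finGroupType) (G : {group gT}) (chi : 'CF(G))
    (nu : {rmorphism algC -> algC}) k x :
    chi \is a character -> x \in G ->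
    (forall z : algC, (z ^+ #[x] = 1)%R -> nu z = (z ^+ k)%R) ->
  nu (chi x) = chi (x ^+ k).
Proof.
move=> Nchi Gx nuE; have Xx := cycle_id x.
have sXG : <[x]> \subset G by rewrite cycle_subG.
rewrite -(cfResE chi sXG Xx) -(cfResE chi sXG (groupX k Xx)).
have [r ->] := char_sum_irr (cfRes_char <[x]> Nchi).
rewrite !sum_cfunE rmorph_sum; apply: eq_bigr => i _.
have Li : ('chi_i)%R \is a linear_char.
  by rewrite irr_cyclic_lin // cycle_cyclic.
by rewrite lin_charX //; apply: nuE; rewrite -lin_charX // expg_order lin_char1.
Qed.

(** Rational numbers are the fixed elements of the Galois group of the
cyclotomic field of order #[x], and each Galois automorphism raises the roots
of unity to some power k prime to #[x]. *)
Lemma Crat_char_val (gT : finGroupType) (G : {group gT}) (chi : 'CF(G)) x :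
    chi \is a character -> x \in G ->
  (chi x \in Crat) <-> (forall k, coprime k #[x] -> chi (x ^+ k) = chi x).
Proof.
move=> Nchi Gx; split=> [Qchi k co_k | fix_chi].
  have [nu nuE] := Qn_aut_exists co_k.
  by rewrite -(cfAut_expg Nchi Gx nuE) aut_Crat.
have [Qn galQn [QnC gQnC [w [pr_w _] Qn_g]]] := group_num_field_exists <[x]>.
have [a Da] := Qn_g _ G _ Nchi x (dvdnn _).
suffices /vlineP[q Dq] : a \in 1%VS.
  by rewrite -Da Dq rmorphZ_num rmorph1 mulr1 Crat_rat.
rewrite -(galois_fixedField galQn); apply/fixedFieldP; first exact: memvf.
move=> sigma sigma_gal; apply: (fmorph_inj QnC).
have [nu Dnu] := gQnC sigma; rewrite /= Dnu Da.
have pr_z : (#[x].-primitive_root (QnC w))%R by rewrite fmorph_primitive_root.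
have pr_nuz : (#[x].-primitive_root (nu (QnC w)))%R.
  by rewrite fmorph_primitive_root.
(* The image of a primitive root is primitive, so k is prime to #[x]. *)
have [k Dk] := prim_rootP pr_z (prim_expr_order pr_nuz).
rewrite -[RHS](fix_chi k); last first.
  by move: pr_nuz; rewrite Dk prim_root_exp_coprime.
apply: cfAut_expg => // z /(prim_rootP pr_z)[m ->].
by rewrite rmorphXn /= Dk exprAC.
Qed.

(** By Frobenius reciprocity, since restricting the induced character back to
the normal subgroup G gives a multiple of the sum of the K-conjugates. *)
Lemma cfdot_Ind_nconjg (gT : finGroupType) (G K : {group gT}) (i j : Iirr G) :
    G <| K -> j \notin cfclass_Iirr K i ->
  ('['Ind[K] 'chi_i, 'Ind[K] 'chi_j] = 0)%R.
Proof.
move=> nsGK conj'j; rewrite -cfdot_Res_l cfResInd //.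
rewrite cfdotZl cfdot_suml big1 ?mulr0 // => y Ky.
rewrite -conjg_IirrE cfdot_irr; case: eqP => // def_j.
by rewrite -def_j imset_f in conj'j.
Qed.

(** * The actions of the units of Z/N *)

Section PowerAction.

Variables (gT : finGroupType) (N : nat).
Hypotheses (N_gt1 : 1 < N) (expN : forall x : gT, x ^+ N = 1).

Definition unit_expg (x : gT) (u : {unit 'Z_N}) : gT := x ^+ (val u : 'Z_N).

Lemma coprime_Zp_unit (u : {unit 'Z_N}) : coprime (val u : 'Z_N) N.
Proof. by rewrite coprime_sym -unitZpE // natr_Zp (valP u). Qed.

Lemma unit_expg_lift (x : gT) k : coprime k #[x] ->
  exists u : {unit 'Z_N}, unit_expg x u = x ^+ k.
Proof.
move=> co_k; have k1_gt0 : 0 < k + #[x] by rewrite addn_gt0 order_gt0 orbT.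
have co_k1 : coprime (k + #[x]) #[x].
  by rewrite coprime_sym /coprime gcdnDr -/(coprime _ _) coprime_sym.
(* The lift needs a positive exponent, hence the shift of k by #[x]. *)
have [m co_m mk] := coprime_lift k1_gt0 (ltnW N_gt1) co_k1.
have Um : ((m%:R : 'Z_N) \is a GRing.unit)%R by rewrite unitZpE // coprime_sym.
exists (Sub (m%:R : 'Z_N)%R Um).
rewrite /unit_expg SubK val_Zp_nat // expg_mod //.
by rewrite -(expg_mod_order x) mk modnDr expg_mod_order.
Qed.

Lemma mem_unit_expg (G : {group gT}) x u : x \in G -> unit_expg x u \in G.
Proof. exact: groupX. Qed.

Lemma rational_unit_expg (G : {group gT}) x u :
  rational_element G x -> unit_expg x u \in x ^: G.
Proof.
case/rational_elementP=> _; apply.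
by apply: coprime_dvdr (coprime_Zp_unit u); rewrite order_dvdn expN.
Qed.

Lemma unit_expg1 x : unit_expg x 1 = x.
Proof. by rewrite /unit_expg /= modn_small ?Zp_cast. Qed.

Lemma unit_expgM x u v : unit_expg x (u * v) = unit_expg (unit_expg x u) v.
Proof. by rewrite /unit_expg -expgM; apply: expg_mod; rewrite Zp_cast. Qed.

Fact unit_expg_is_action : is_action setT unit_expg.
Proof. exact: is_total_action unit_expg1 unit_expgM. Qed.

Definition power_action := Action unit_expg_is_action.

Lemma power_action_class (G : {group gT}) x u : x \in G ->
  (power_action^* (x ^: G) u)%act = unit_expg x u ^: G.
Proof.
move=> Gx; rewrite /= /setact; apply/setP=> y; apply/imsetP/imsetP.
  by case=> _ /imsetP[z Gz ->] ->; exists z; rewrite // /= /unit_expg conjXg.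
case=> z Gz ->; exists (x ^ z); first exact: memJ_class.
by rewrite /= /unit_expg conjXg.
Qed.

Lemma acts_power_classes (G : {group gT}) :
  [acts [set: {unit 'Z_N}], on classes G | power_action^*].
Proof.
apply/actsP=> u _ C; apply/idP/idP; last first.
  case/imsetP=> x Gx ->.
  by rewrite power_action_class // mem_classes ?mem_unit_expg.
move/imsetP=> [x Gx] /(canRL (actK _ _)) ->.
by rewrite power_action_class // mem_classes ?mem_unit_expg.
Qed.

Lemma rational_classes_fix (G : {group gT}) :
  rational_classes G = 'Fix_(classes G | power_action^*)([set: {unit 'Z_N}]).
Proof.
apply/setP=> C; rewrite [LHS]inE in_setI; apply: andb_id2l => /imsetP[x Gx ->].
apply/asboolP/afixP => [[g rat_g ->] u _ | fixC].
  rewrite power_action_class; last by case: rat_g.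
  exact/class_eqP/rational_unit_expg.
exists x => //; apply/rational_elementP; split=> // k co_k.
have [u <-] := unit_expg_lift co_k.
have Cu := power_action_class u Gx.
by rewrite -[x ^: G](fixC u) ?inE // Cu class_refl.
Qed.

Definition unit_aut (u : {unit 'Z_N}) : {rmorphism algC -> algC} :=
  sval (Qn_aut_exists (coprime_Zp_unit u)).

Lemma unit_autE (G : {group gT}) (chi : 'CF(G)) u x :
    chi \is a character -> x \in G ->
  unit_aut u (chi x) = chi (unit_expg x u).
Proof.
move=> Nchi Gx; apply: cfAut_expg => // z z1.
rewrite /unit_aut; case: (Qn_aut_exists _) => /= nu; apply.
have /dvdnP[m ->] : #[x] %| N by rewrite order_dvdn expN.
by rewrite mulnC exprM z1 expr1n.
Qed.

(** The inverse makes the action compatible with the power action: moving both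
the character and the group element by u leaves the value unchanged, which is
the form required by Brauer's permutation lemma. *)
Definition galois_Iirr (G : {group gT}) (i : Iirr G) u :=
  aut_Iirr (unit_aut u^-1) i.

Lemma galois_IirrE (G : {group gT}) (i : Iirr G) u x : x \in G ->
  ('chi_(galois_Iirr i u) x)%R = ('chi_i)%R (unit_expg x u^-1).
Proof. by move=> Gx; rewrite aut_IirrE cfunE unit_autE ?irr_char. Qed.

Fact galois_Iirr_is_action (G : {group gT}) : is_action setT (@galois_Iirr G).
Proof.
apply: is_total_action => [i | i u v]; apply/irr_inj/cfun_inP=> x Gx.
  by rewrite galois_IirrE // invg1 unit_expg1.
by rewrite !galois_IirrE ?mem_unit_expg // invMg unit_expgM.
Qed.

Definition galois_action (G : {group gT}) := Action (galois_Iirr_is_action G).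

Lemma rational_irr_fix (G : {group gT}) :
  rational_irr G = 'Fix_(galois_action G)([set: {unit 'Z_N}]).
Proof.
apply/setP=> i; rewrite inE; apply/asboolP/afixP => [Qi u _ | fix_i x Gx].
  apply/irr_inj/cfun_inP=> x Gx; rewrite galois_IirrE //.
  apply: (iffLR (Crat_char_val (irr_char i) Gx) (Qi x Gx)).
  by apply: coprime_dvdr (coprime_Zp_unit _); rewrite order_dvdn expN.
apply/Crat_char_val=> // [|k co_k]; first exact: irr_char.
have [u <-] := unit_expg_lift co_k.
by rewrite -[in RHS](fix_i u^-1) ?inE //= galois_IirrE // invgK.
Qed.

Lemma acts_galois (G : {group gT}) :
  [acts [set: {unit 'Z_N}], on [set: Iirr G] | galois_action G].
Proof. by apply/actsP=> u _ i; rewrite !inE. Qed.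

(** Cauchy-Frobenius: both numbers are averages, over the units, of fixed-point
counts that agree by Brauer's permutation lemma. *)
Lemma card_power_galois_orbits (G : {group gT}) :
  #|orbit (power_action^*) [set: {unit 'Z_N}] @: classes G|
    = #|orbit (galois_action G) [set: {unit 'Z_N}] @: setT|.
Proof.
have acts_i := acts_galois G.
have A_gt0 := cardG_gt0 [set: {unit 'Z_N}].
apply/eqP; rewrite -(eqn_pmul2r A_gt0).
rewrite -!Frobenius_Cauchy //; last exact: acts_power_classes.
apply/eqP/eq_bigr=> u _; rewrite setTI.
rewrite -(@card_afix_irr_classes _ _ _ _ (galois_action G)) //.
  exact: acts_power_classes.
move=> i x y Gx; rewrite power_action_class // => /imsetP[z Gz ->].
rewrite cfunJ // galois_IirrE ?mem_unit_expg //.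
by rewrite -[LHS](congr1 _ (actK power_action u x)).
Qed.

(** The character induced to K is rational-valued, so it is the same for an
irreducible character of G and for its Galois conjugates. Characters of G that
are not K-conjugate induce orthogonal characters. *)
Lemma galois_conjg (G K : {group gT}) i u :
    G <| K -> (forall x, x \in K -> rational_element K x) ->
  galois_action G i u \in cfclass_Iirr K i.
Proof.
move=> nsGK ratK; have aut_id (psi : 'CF(K)) :
    psi \is a character -> cfAut (unit_aut u^-1) psi = psi.
  move=> Npsi; apply/cfun_inP=> x Kx; rewrite cfunE unit_autE //.
  have /imsetP[y Ky ->] := rational_unit_expg u^-1 (ratK x Kx).
  exact: cfunJ.
apply: contraT => /(cfdot_Ind_nconjg nsGK)/eqP.
rewrite aut_IirrE -cfAutInd aut_id ?cfInd_char ?irr_char //.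
by rewrite cfnorm_eq0 (negPf (Ind_irr_neq0 _ (normal_sub nsGK))).
Qed.

Lemma card_rational_classes_irr_expg (G K : {group gT}) :
    G <| K -> #|K : G| <= 2 -> (forall x, x \in K -> rational_element K x) ->
  #|rational_classes G| = #|rational_irr G|.
Proof.
move=> nsGK iGK ratK; have [sGK nGK] := andP nsGK.
have cardE : #|classes G| = #|[set: Iirr G]|.
  by rewrite cardsT card_ord NirrE.
have orb_class C : C \in classes G ->
    #|orbit (power_action^*) [set: {unit 'Z_N}] C| <= 2.
  case/imsetP=> x Gx ->; apply: leq_trans iGK.
  apply: (@leq_trans #|(x ^: G) :^: K|).
    apply/subset_leq_card/subsetP=> _ /orbitP[u _ <-].
    have Kx := subsetP sGK x Gx; rewrite power_action_class //.
    have /imsetP[y Ky ->] := rational_unit_expg u (ratK x Kx).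
    apply/imsetP; exists y => //.
    by rewrite -class_rcoset norm_rlcoset ?(subsetP nGK) // class_lcoset.
  rewrite card_conjugates dvdn_leq ?indexg_gt0 ?indexgS //.
  by rewrite subsetI sGK class_norm.
have orb_irr i : i \in [set: Iirr G] ->
    #|orbit (galois_action G) [set: {unit 'Z_N}] i| <= 2.
  move=> _; apply: leq_trans iGK; apply: (@leq_trans #|cfclass_Iirr K i|).
    by apply/subset_leq_card/subsetP=> _ /orbitP[u _ <-]; apply: galois_conjg.
  rewrite card_cfclass_Iirr // dvdn_leq ?indexg_gt0 ?indexgS //.
  by rewrite subsetI sGK sub_inertia.
have := card_fix_orbits_le2 (acts_power_classes G) orb_class.
rewrite card_power_galois_orbits -(card_fix_orbits_le2 (acts_galois G)) //.
by rewrite cardE rational_classes_fix rational_irr_fix setTI; apply: addnI.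
Qed.

End PowerAction.

(** * Alternating groups *)

(** The orbits of both unit actions embed in K-conjugacy orbits, whose size is
at most the index of G. *)
Theorem card_rational_classes_irr (gT : finGroupType) (G K : {group gT}) :
    G <| K -> #|K : G| <= 2 -> (forall x, x \in K -> rational_element K x) ->
  #|rational_classes G| = #|rational_irr G|.
Proof.
(* Doubling the order keeps the modulus above 1 when gT is trivial. *)
apply: (@card_rational_classes_irr_expg _ (#|[set: gT]|.*2)) => [|x].
  by rewrite -addnn (@leq_add 1 1) ?cardG_gt0.
by apply/eqP; rewrite -order_dvdn -muln2 dvdn_mulr // order_dvdG ?inE.
Qed.

Theorem theorem1p7 (n : nat) (hn : 4 <= n) :
  #|rational_classes 'Alt_('I_n)%G| = #|rational_irr 'Alt_('I_n)%G|.
Proof.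
apply: (@card_rational_classes_irr _ _ 'Sym_('I_n)%G).
- exact: Alt_normal.
- by rewrite Alt_index // card_ord; apply: leq_trans hn.
move=> s _; apply/rational_elementP; split=> [|k co_k]; first by rewrite inE.
by have [t <-] := perm_conj_expg co_k; rewrite memJ_class ?inE.
Qed.
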